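(* Let $(x^k)_{k\in\mathbb{N}}$ be an infinite sequence generated by GInexPM with Armijo search (as described in the context), and assume that $f$ is pseudoconvex. Then $\Omega^*\neq\varnothing$ if and only if $(x^k)_{k\in\mathbb{N}}$ has at least one cluster point. Moreover, if $\Omega^*\neq\varnothing$ then $(x^k)_{k\in\mathbb{N}}$ converges to a point of $\Omega^*$; otherwise, $\lim_{k\to\infty}\|x^k\|=\infty$ and $\lim_{k\to\infty}f(x^k)=\inf\{f(x):x\in C\}$ (possibly $-\infty$).
   Context: Setting. $C\subset\mathbb{R}^n$ is a nonempty closed convex set, $f:\mathbb{R}^n\to\mathbb{R}$ is continuously differentiable, $\Omega^*$ is the (possibly empty) set of minimizers of $f$ over $C$; $\langle\cdot,\cdot\rangle$ and $\|\cdot\|$ are the Euclidean inner product and norm; $\mathbb{N}=\{0,1,2,\dots\}$. $f$ is pseudoconvex if, for all $x,y\in C$, $\langle\nabla f(y),x-y\rangle\ge 0$ implies $f(x)\ge f(y)$. Inexact projection. For each $\gamma_3\ge 0$, $\varphi_{\gamma_3}:\mathbb{R}^n\times\mathbb{R}^n\to[0,\infty)$ is a function with $\varphi_{\gamma_3}(u,w)\le\gamma_3\|w-u\|^2$ for all $u,w$, and the map $(\gamma_3,u,w)\mapsto\varphi_{\gamma_3}(u,w)$ is continuous. For $u\in C$, $v\in\mathbb{R}^n$, $\mathcal{P}_C(\varphi_{\gamma_3},u,v):=\{w\in C:\langle v-w,y-w\rangle\le\varphi_{\gamma_3}(u,w)\ \forall y\in C\}$. GInexPM with Armijo search. Fix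 $\sigma,\tau\in(0,1)$, $0<\alpha_{\min}\le\alpha_{\max}$, $\bar\gamma<1/2$, and $x^0\in C$. At iteration $k$: choose reals $\alpha_k,\gamma_3^k$ with $\alpha_{\min}\le\alpha_k\le\alpha_{\max}$ and $0\le\gamma_3^k\le\bar\gamma$, set $z^k:=x^k-\alpha_k\nabla f(x^k)$ and take any $w^k\in\mathcal{P}_C(\varphi_{\gamma_3^k},x^k,z^k)$. If $w^k=x^k$, stop. Otherwise set $\tau_k:=\tau^{j_k}$ with $j_k:=\min\{j\in\mathbb{N}: f(x^k+\tau^j(w^k-x^k))\le f(x^k)+\sigma\tau^j\langle\nabla f(x^k),w^k-x^k\rangle\}$ and $x^{k+1}:=x^k+\tau_k(w^k-x^k)$. ''Infinite sequence generated'' means the algorithm never stops (a standing assumption of the paper). *)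

(* Defs.v *)
From HB Require Import structures.
From mathcomp Require Import all_boot all_order all_algebra.
From mathcomp Require Import all_classical all_reals all_analysis.

Set Implicit Arguments.
Unset Strict Implicit.
Unset Printing Implicit Defensive.

Import Order.TTheory GRing.Theory Num.Theory.
Import numFieldNormedType.Exports.

Local Open Scope classical_set_scope.
Local Open Scope ring_scope.

(* R^n is 'rV[R]_n. The norm `|_| of the library on matrices is the sup norm,
   hence the separate Euclidean norm [enorm] used in every formula; the
   topology (closed sets, continuity, limits, cluster points) is that of the
   library, which is the Euclidean one since the two norms are equivalent. *)
Section Euclidean.
Context {R : realType} {n : nat}.
Implicit Types (f : 'rV[R]_n -> R) (C : set 'rV[R]_n) (x y u v w : 'rV[R]_n).

Definition dot u v : R := \sum_(i < n) u 0 i * v 0 i.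

Definition enorm u : R := Num.sqrt (dot u u).

Definition gradient f x : 'rV[R]_n :=
  \row_(i < n) 'D_(delta_mx 0 i) f x.

Definition C1 f : Prop :=
  (forall x, differentiable f x) /\ continuous (gradient f).

Definition minimizers f C : set 'rV[R]_n :=
  [set x | C x /\ forall y, C y -> f x <= f y].

Definition pseudoconvex_on f C : Prop :=
  forall x y, C x -> C y -> 0 <= dot (gradient f y) (x - y) -> f y <= f x.

End Euclidean.

Section GInexPM.
Context {R : realType} {n : nat}.
Implicit Types (f : 'rV[R]_n -> R) (C : set 'rV[R]_n) (x u v w d : 'rV[R]_n).
Implicit Type phi : R -> 'rV[R]_n -> 'rV[R]_n -> R.

(* The tolerance [phi gamma] is meaningful for [0 <= gamma] only: nothing is
   required of it elsewhere. *)
Definition error_tolerance phi : Prop :=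
  [/\ forall gamma u w, 0 <= gamma -> 0 <= phi gamma u w,
      forall gamma u w, 0 <= gamma ->
        phi gamma u w <= gamma * enorm (w - u) ^+ 2 &
      {within [set p : R * 'rV[R]_n * 'rV[R]_n | 0 <= p.1.1],
        continuous (fun p => phi p.1.1 p.1.2 p.2)}].

Definition inexact_proj C (tol : 'rV[R]_n -> 'rV[R]_n -> R) u v :
    set 'rV[R]_n :=
  [set w | C w /\ forall y, C y -> dot (v - w) (y - w) <= tol u w].

Definition armijo f (sigma tau : R) x d (j : nat) : Prop :=
  f (x + tau ^+ j *: d)
    <= f x + sigma * tau ^+ j * dot (gradient f x) d.

Definition armijo_index f (sigma tau : R) x d (j : nat) : Prop :=
  armijo f sigma tau x d j /\
  forall i : nat, armijo f sigma tau x d i -> (j <= i)%N.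

Definition GInexPM_step f C phi (sigma tau amin amax gbar : R) x x' : Prop :=
  exists (alpha gamma : R) w (j : nat),
    [/\ amin <= alpha <= amax, 0 <= gamma <= gbar,
        inexact_proj C (phi gamma) x (x - alpha *: gradient f x) w,
        w <> x (* the stopping test fails *) &
        armijo_index f sigma tau x (w - x) j /\
        x' = x + tau ^+ j *: (w - x)].

Definition GInexPM_generated f C phi (sigma tau amin amax gbar : R) x0
    (x : nat -> 'rV[R]_n) : Prop :=
  x 0%N = x0 /\
  forall k, GInexPM_step f C phi sigma tau amin amax gbar (x k) (x k.+1).

End GInexPM.

(* Main.v *)
Require Import Defs.
From HB Require Import structures.
From mathcomp Require Import all_boot all_order all_algebra.
From mathcomp Require Import all_classical all_reals all_analysis.
From mathcomp Require Import ring lra.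

Set Implicit Arguments.
Unset Strict Implicit.
Unset Printing Implicit Defensive.

Import Order.TTheory GRing.Theory Num.Theory.
Import numFieldNormedType.Exports.

Local Open Scope classical_set_scope.
Local Open Scope ring_scope.

(** The step satisfies a quasi-Fejer inequality whose error is paid for by the
    decrease of f, and this yields an exact Lyapunov function. Write g for the
    gradient of f at x, d = w - x for the direction, t for the Armijo step and
    q = - <g, d>. The projection inequality at a point y of C, whose tolerance
    is at most |d|^2 / 2, gives
      |x' - y|^2 <= |x - y|^2 + 2 t alpha <g, y - x> + 2 t alpha q,
    while the Armijo test gives sigma t q <= f x - f x'
    ([GInexPM_descent_step]). If f y < f x then <g, y - x> < 0 by
    pseudoconvexity, so u |-> |u - y|^2 + (2 amax / sigma) f u decreases along
    the step ([descent_step_lyapunov]).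

    Let T be the set of the y in C with f y <= f (x k) for all k. For y in T the
    Lyapunov function shows that the sequence is bounded, hence has a cluster
    point. Conversely a cluster point p belongs to T, as C is closed and f
    decreases along the sequence, and the Lyapunov function centred at p, being
    monotone along the sequence and continuous, tends to its value at p
    ([cluster_nonincreasing_cvg]); as f (x k) tends to f p, the whole sequence
    converges to p.

    A limit p of the sequence is stationary ([descent_limit_stationary]): the
    slopes q tend to 0, since either t = 1 and q is at most the decrease of f
    over sigma, or the test failed at t / tau and the mean value theorem bounds
    q by the squared variation of the gradient near x
    ([descent_step_slope_le]). Then d tends to 0 too, and the projection
    inequality passes to the limit as 0 <= <gradient f p, y - p>, so p minimizes
    f on C by pseudoconvexity.

    Hence minimizers exist iff cluster points do, a minimizer being in T. If
    there are none, the sequence leaves every compact set, and T is empty, that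
    is, the values f (x k) go below f y for every y in C. *)

(** * Euclidean geometry of row vectors *)

Section Euclidean.
Context {R : realType} {n : nat}.
Implicit Types (u v w : 'rV[R]_n) (f : 'rV[R]_n -> R).

Lemma dotC u v : dot u v = dot v u.
Proof. by apply: eq_bigr => i _; rewrite mulrC. Qed.

Lemma dotDl u v w : dot (u + v) w = dot u w + dot v w.
Proof. by rewrite -big_split; apply: eq_bigr => i _; rewrite mxE mulrDl. Qed.

Lemma dotZl a u v : dot (a *: u) v = a * dot u v.
Proof. by rewrite mulr_sumr; apply: eq_bigr => i _; rewrite mxE mulrA. Qed.

Lemma dotNl u v : dot (- u) v = - dot u v.
Proof. by rewrite -scaleN1r dotZl mulN1r. Qed.

Lemma dotDr u v w : dot u (v + w) = dot u v + dot u w.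
Proof. by rewrite dotC dotDl !(dotC u). Qed.

Lemma dotZr a u v : dot u (a *: v) = a * dot u v.
Proof. by rewrite dotC dotZl dotC. Qed.

Lemma dotNr u v : dot u (- v) = - dot u v.
Proof. by rewrite dotC dotNl dotC. Qed.

Lemma dot0r u : dot u 0 = 0.
Proof. by rewrite -(scale0r u) dotZr mul0r. Qed.

Definition dotE := (dotDl, dotDr, dotZl, dotZr, dotNl, dotNr).

Lemma dot_ge0 u : 0 <= dot u u.
Proof. by apply: sumr_ge0 => i _; rewrite -expr2 sqr_ge0. Qed.

(** The topology is that of the sup norm; its domination by the Euclidean norm
    turns Euclidean bounds and limits into topological ones. *)
Lemma norm_sqr_le_dot u : `|u| ^+ 2 <= dot u u.
Proof.
have [->|u0] := eqVneq `|u| 0; first by rewrite expr0n dot_ge0.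
have [[i j] /= uij] := mx_norm_neq0 u0; rewrite {}[`|u|]uij.
rewrite (ord1 i) -normrX ger0_norm ?sqr_ge0// /dot (bigD1 j)//= -expr2 lerDl.
by apply: sumr_ge0 => k _; rewrite -expr2 sqr_ge0.
Qed.

Lemma dot_gt0 u : u != 0 -> 0 < dot u u.
Proof.
move=> u0; apply: lt_le_trans (norm_sqr_le_dot u).
by rewrite exprn_gt0// normr_gt0.
Qed.

(** Young's inequality: the square of [u - 2 e v] is nonnegative. Its weight [e]
    lets a multiple of [dot v v] be absorbed elsewhere. *)
Lemma dot_young u v e : 0 < e ->
  dot u v <= (4 * e)^-1 * dot u u + e * dot v v.
Proof.
move=> e0; have := dot_ge0 (u - (2 * e) *: v); rewrite !dotE (dotC v u) => h.
have e4 : 0 < 4 * e by lra.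
rewrite -(ler_pM2l e4) mulrDr mulrA mulfV ?gt_eqF// mul1r; nra.
Qed.

Lemma cvg_dot {T : Type} (F : set_system T) {FF : Filter F}
    (u v : T -> 'rV[R]_n) (a b : 'rV[R]_n) :
  u @ F --> a -> v @ F --> b -> dot (u k) (v k) @[k --> F] --> dot a b.
Proof.
move=> ua vb; rewrite /dot.
have coord (w : T -> 'rV[R]_n) (c : 'rV[R]_n) i :
    w @ F --> c -> w k 0 i @[k --> F] --> c 0 i.
  move=> wc; apply: (cvg_comp _ (fun M : 'rV[R]_n => M 0 i) wc).
  exact: coord_continuous.
apply: (cvg_big (@add_continuous R)) => i _.
exact: cvgM (coord _ _ _ ua) (coord _ _ _ vb).
Qed.

Lemma cvg_dot_sub0 {T : Type} (F : set_system T) {FF : Filter F}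
    (u : T -> 'rV[R]_n) (a : 'rV[R]_n) :
  dot (u k - a) (u k - a) @[k --> F] --> 0 -> u @ F --> a.
Proof.
move=> h; apply/cvgrPdist_lt => e e0.
have e2 : 0 < e ^+ 2 by rewrite exprn_gt0.
have /cvgrPdist_lt/(_ _ e2) := h; apply: filterS => k.
rewrite sub0r normrN ger0_norm ?dot_ge0// distrC => hk.
have := le_lt_trans (norm_sqr_le_dot _) hk.
by rewrite ltr_pXn2r// nnegrE ?normr_ge0// ltW.
Qed.

Lemma continuous_dist_sqr (a : 'rV[R]_n) :
  continuous (fun v : 'rV[R]_n => dot (v - a) (v - a)).
Proof.
move=> v; have va : (u - a) @[u --> v] --> v - a.
  exact: (cvgB cvg_id (cvg_cst a)).
exact: (cvg_dot va va).
Qed.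

Lemma compact_euclidean_ball a M :
  compact [set v : 'rV[R]_n | dot (v - a) (v - a) <= M].
Proof.
apply: bounded_closed_compact.
  exists (`|a| + M + 1); split; first exact: num_real.
  move=> r rM v /= vM; apply: le_trans (ltW rM).
  have h := le_trans (norm_sqr_le_dot _) vM.
  have : `|v - a| <= M + 1 by have := sqr_ge0 (`|v - a| - 1); nra.
  have := ler_normD (v - a) a; rewrite subrK; lra.
have cl : closed ((fun v => dot (v - a) (v - a)) @^-1` [set r | r <= M]).
  apply: preimage_closed; last exact: closed_le.
  by move=> v _; exact: continuous_dist_sqr.
exact: cl.
Qed.

Lemma derive_gradient f p v :
  differentiable f p -> 'D_v f p = dot (gradient f p) v.
Proof.
move=> df; rewrite deriveE// {1}(row_sum_delta v) linear_sum.
by apply: eq_bigr => i _; rewrite linearZ /= mxE deriveE// mulrC.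
Qed.

(** The mean value theorem for [s |-> f (p + s v)] on the unit interval. *)
Lemma MVT_gradient f p v : (forall q, differentiable f q) ->
  exists2 s, 0 <= s <= 1 & f (p + v) - f p = dot (gradient f (p + s *: v)) v.
Proof.
move=> df; pose g (s : R) := f (s *: v + p).
have dline (s : R) : is_derive s 1 g (dot (gradient f (p + s *: v)) v).
  (* both derivatives are limits of one and the same difference quotient *)
  have E : (fun h : R => h^-1 *: ((g \o shift s) (h *: (1 : R)) - g s)) =
      (fun h : R => h^-1 *: ((f \o shift (p + s *: v)) (h *: v)
                             - f (p + s *: v))).
    apply/funext => h /=; rewrite /g [h *: 1]mulr1 scalerDl -addrA.
    by rewrite [s *: v + p]addrC.
  rewrite -derive_gradient//; split; rewrite /derivable /derive E//.
  exact: diff_derivable.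
have gc : {within `[0, 1], continuous g}.
  apply: continuous_subspaceT => s; apply: differentiable_continuous.
  by apply/derivable1_diffP; have [] := dline s.
have [s] := MVT_segment ler01 (fun s _ => dline s) gc.
rewrite in_itv /= => s01 gE.
exists s => //; move: gE.
by rewrite /g scale1r scale0r add0r subr0 mulr1 [v + p]addrC.
Qed.

End Euclidean.

(** * Cluster points of sequences *)

(** The sequence returns arbitrarily late to points where [h] is close to
    [h p], and monotonicity keeps the later values of [h] in between: no
    subsequence has to be extracted. *)
Lemma cluster_nonincreasing_cvg {R : realType} {T : topologicalType}
    (h : T -> R) (x : nat -> T) p :
  {for p, continuous h} -> nonincreasing_seq (h \o x) ->
  cluster (x @ \oo) p -> h (x k) @[k --> \oo] --> h p.
Proof.
move=> hc dec clp.
have visit N (e : R) : 0 < e -> exists2 m, (N <= m)%N & `|h p - h (x m)| < e.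
  move=> e0; have V : nbhs p [set u | `|h p - h u| < e].
    by move/cvgrPdist_lt : hc; apply.
  have tail : (x @ \oo) [set x m | m in [set m | (N <= m)%N]].
    by exists N => // m /= Nm; exists m.
  by have [_ [[m Nm <-] hm]] := clp _ _ tail V; exists m.
have lb k : h p <= h (x k).
  rewrite leNgt; apply/negP => lt; rewrite -subr_gt0 in lt.
  have [m km] := visit k _ lt; have /= := dec _ _ km.
  rewrite ltr_norml => ? /andP[_]; lra.
apply/cvgrPdist_lt => e e0; have [N _ hN] := visit 0%N e e0.
exists N => // k /= Nk; have /= dk := dec _ _ Nk.
by move: hN; rewrite !ltr_norml => /andP[? ?]; have := lb k; lra.
Qed.

(** If the sequence were often in [K], the indices [k] with [K (x k)] would
    define a proper filter refining the tails, with a cluster point in [K]. *)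
Lemma cluster0_compact_near_notin {T : topologicalType} (x : nat -> T)
    (K : set T) :
  compact K -> cluster (x @ \oo) = set0 -> \forall k \near \oo, ~ K (x k).
Proof.
move=> cK cl0; apply: contrapT => often.
pose F := within [set k | K (x k)] \oo.
have FP : ProperFilter F by apply: Build_ProperFilter; exact: often.
have [|p [_ clp]] := cK (x @ F) _.
  by exists 0%N => // k _ /=.
have : cluster (x @ \oo) p by apply: cvg_cluster clp => A; exact: cvg_within.
by rewrite cl0.
Qed.

Lemma cluster_closed {T : topologicalType} (A : set T) (u : nat -> T) p :
  closed A -> (forall k, A (u k)) -> cluster (u @ \oo) p -> A p.
Proof.
move=> cA uA clp; apply: cA => B pB.
by apply: clp pB; exists 0%N => // k _; exact: uA.
Qed.

Lemma cluster0_enorm_cvgy {R : realType} {n : nat} (x : nat -> 'rV[R]_n) :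
  cluster (x @ \oo) = set0 -> enorm (x k) @[k --> \oo] --> +oo.
Proof.
move=> cl0; apply/cvgryPgt => A.
have ball_compact := @compact_euclidean_ball R n 0 (A ^+ 2).
have := cluster0_compact_near_notin ball_compact cl0.
apply: filterS => k /= /negP; rewrite subr0 -ltNge => Ak.
apply: le_lt_trans (ler_norm A) _.
by rewrite -sqrtr_sqr ltr_sqrt// (le_lt_trans _ Ak)// sqr_ge0.
Qed.

(** * One step of the method *)

Section Step.
Context {R : realType} {n : nat}.
Implicit Types (C : set 'rV[R]_n) (f : 'rV[R]_n -> R) (x d w : 'rV[R]_n).
Implicit Types (phi : R -> 'rV[R]_n -> 'rV[R]_n -> R).

(** What the convergence analysis retains from one step, the Armijo exponent
    and the tolerance being eliminated: [alpha] is the gradient step size, [t]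
    the accepted fraction of the direction [d], and [q] the slope of descent. In
    the fourth clause [t / tau] is the last step length that the line search
    rejected. The two inequalities for [y] are the variational inequality of the
    inexact projection, without its favourable [dot d d] term, and the
    quasi-Fejer inequality. *)
Definition descent_step C f (sigma tau amin amax : R) x x' (alpha t : R) d :
    Prop :=
  let q := - dot (gradient f x) d in
  [/\ amin <= alpha <= amax /\ 0 < t <= 1,
      x' = x + t *: d /\ C x',
      [/\ 0 < q, dot d d <= 2 * amax * q & f x' <= f x - sigma * t * q],
      t = 1 \/ f x - sigma * (t / tau) * q < f (x + (t / tau) *: d) &
      forall y, C y ->
        0 <= alpha * dot (gradient f x) (y - x) + alpha * q + dot d (y - x) /\
        dot (x' - y) (x' - y) <= dot (x - y) (x - y)
          + 2 * t * alpha * (dot (gradient f x) (y - x) + q)].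

Lemma convex_set_step C x w (t : R) :
  convex_set C -> C x -> C w -> 0 <= t <= 1 -> C (x + t *: (w - x)).
Proof.
move=> C_convex Cx Cw t01.
have [t0 t1] := andP t01.
have -> : x + t *: (w - x) = t *: w + (1 - t) *: x.
  by rewrite scalerBr scalerBl scale1r addrCA.
exact: set_mem (C_convex _ _ (Itv01 t0 t1) (mem_set Cw) (mem_set Cx)).
Qed.

(** Everything comes from the projection inequality [proj'], used at [y = x] for
    the bounds on the slope and at any [y] for the last clause. There
    [gbar < 1 / 2] and [t <= 1] matter: the square of [t d] contributes
    [t^2 |d|^2], at most the [2 t (1 - gam) |d|^2] gained. *)
Lemma GInexPM_descent_step C f phi (sigma tau amin amax gbar : R) x x' :
  convex_set C -> error_tolerance phi -> 0 < sigma < 1 -> 0 < tau < 1 ->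
  0 < amin -> gbar < 1 / 2 -> C x ->
  GInexPM_step f C phi sigma tau amin amax gbar x x' ->
  exists alpha t d, descent_step C f sigma tau amin amax x x' alpha t d.
Proof.
move=> C_convex phi_tol sigma01 tau01 amin_gt0 gbar_lt Cx.
move=> [alpha [gam [w [j [aa /andP[g0 gg] [Cw proj] wx [[arm armmin] ->]]]]]].
(* the projected point is renamed [d + x], so that [d] becomes a variable *)
move: Cw proj wx arm armmin; rewrite -[w](subrK x); move: (w - x) => d {w}.
rewrite addrK => Cw proj wx arm armmin.
have [_ phi_le _] := phi_tol; set g := gradient f x.
have [a1 a2] := andP aa; have [t1 t2] := andP tau01.
have [s1 s2] := andP sigma01.
have d0 : 0 < dot d d.
  by apply: dot_gt0; apply/eqP => d0; rewrite d0 add0r in wx.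
have gh : gam <= 1 / 2 := le_trans gg (ltW gbar_lt).
have phid : phi gam x (d + x) <= gam * dot d d.
  apply: le_trans (phi_le _ _ _ g0) _.
  by rewrite /enorm addrK sqr_sqrtr// dot_ge0.
have dgam : gam * dot d d <= 1 / 2 * dot d d by rewrite ler_pM2r.
have proj' y : C y -> (1 - gam) * dot d d
    <= alpha * dot g (y - x) - alpha * dot g d + dot d (y - x).
  move=> Cy; have := proj _ Cy.
  have -> : x - alpha *: gradient f x - (d + x) = - (alpha *: g) - d.
    by apply/rowP => i; rewrite !mxE; ring.
  have -> : y - (d + x) = (y - x) - d by apply/rowP => i; rewrite !mxE; ring.
  move=> /le_trans /(_ phid); move: (y - x) => e; rewrite !dotE; lra.
have q_ge : dot d d <= 2 * alpha * - dot g d.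
  have := proj' _ Cx; rewrite subrr !dot0r; lra.
have q0 : 0 < - dot g d by nra.
have t01 : 0 < tau ^+ j <= 1 by rewrite exprn_gt0// exprn_ile1// ltW.
exists alpha, (tau ^+ j), d; split=> //.
- split=> //; rewrite -[d](addrK x); apply: convex_set_step => //; lra.
- split=> //; first by nra.
  by move: arm; rewrite /armijo -/g; lra.
- case: j {arm t01} armmin => [|j] armmin; first by left.
  right; rewrite ltNge; apply/negP => bad.
  have : armijo f sigma tau x d j.
    by move: bad; rewrite exprSr mulfK ?gt_eqF// /armijo -/g; lra.
  by move/armmin; rewrite ltnn.
- move=> y Cy; have := proj' _ Cy; set t := tau ^+ j in t01 *.
  have [tp tl] := andP t01.
  have -> : x + t *: d - y = t *: d - (y - x).
    by apply/rowP => i; rewrite !mxE; ring.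
  rewrite -(opprB y x); move: (y - x) => e; rewrite !dotE (dotC e d) => h.
  split; first lra.
  have : t * (t * dot d d) <= t * dot d d by rewrite ler_pM2l// ler_piMl// ltW.
  have : t * ((1 - gam) * dot d d)
      <= t * (alpha * dot g e - alpha * dot g d + dot d e).
    by rewrite ler_pM2l.
  have : t * (gam * dot d d) <= t * (1 / 2 * dot d d) by rewrite ler_pM2l.
  lra.
Qed.

(** Pseudoconvexity makes [dot (gradient f x) (y - x)] negative, and the
    remaining error [2 t alpha q] of the quasi-Fejer inequality is at most
    [2 amax / sigma] times the decrease of [f], by the Armijo test. *)
Lemma descent_step_lyapunov C f (sigma tau amin amax : R) x x' alpha t d y :
  0 < sigma -> 0 < amin -> pseudoconvex_on f C -> C x -> C y -> f y < f x ->
  descent_step C f sigma tau amin amax x x' alpha t d ->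
  dot (x' - y) (x' - y) + 2 * amax / sigma * f x'
    <= dot (x - y) (x - y) + 2 * amax / sigma * f x.
Proof.
move=> s0 amin0 pseudo Cx Cy fyx [[/andP[a1 a2] /andP[t0 t1]] _ [q0 _ fdec] _].
move=> /(_ _ Cy)[_].
have : dot (gradient f x) (y - x) < 0.
  by rewrite ltNge; apply/negP => /(pseudo _ _ Cy Cx); rewrite leNgt fyx.
move: (dot (gradient f x) (y - x)) fdec q0 => b.
set q := - dot _ d => fdec q0 b0 h.
have c0 : 0 <= 2 * amax / sigma by rewrite divr_ge0//; lra.
have cs : 2 * amax / sigma * sigma = 2 * amax by rewrite divfK// gt_eqF.
have := ler_wpM2l c0 fdec.
have -> : 2 * amax / sigma * (f x - sigma * t * q) =
  2 * amax / sigma * f x - (2 * amax / sigma * sigma) * (t * q) by ring.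
rewrite cs => fdec'.
have tq : 0 < t * q by rewrite mulr_gt0.
have : alpha * (t * q) <= amax * (t * q) by rewrite ler_pM2r.
have : 0 <= t * alpha * - b by rewrite !mulr_ge0//; lra.
lra.
Qed.

End Step.

(** * Stationarity of limits *)

Section Limits.
Context {R : realType} {n : nat}.
Implicit Types (C : set 'rV[R]_n) (f : 'rV[R]_n -> R) (x d : nat -> 'rV[R]_n).

Lemma cvg0_le (u v : nat -> R) : (forall k, 0 <= u k <= v k) ->
  v @ \oo --> 0 -> u @ \oo --> 0.
Proof.
move=> uv v0; apply: (@squeeze_cvgr _ _ _ _ (fun=> 0) v) v0 => //.
  exact: nearW.
exact: cvg_cst.
Qed.

(** Along a convergent sequence both right-hand sides tend to 0, whatever the
    behaviour of the step lengths. If the full step was accepted, [q] is at most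
    the decrease over [sigma] and [z = x0] will do. Otherwise [z] is the mean
    value point between [x0] and the last rejected trial point: the failed test
    reads [(1 - sigma) q < dot (gradient f z - gradient f x0) d0], and Young's
    inequality absorbs [d0], as [dot d0 d0 <= 2 amax q]. *)
Lemma descent_step_slope_le C f (sigma tau amin amax : R) (x0 x' : 'rV[R]_n)
    (alpha t : R) (d0 : 'rV[R]_n) : (forall p, differentiable f p) ->
  0 < sigma < 1 -> 0 < tau -> 0 < amin ->
  descent_step C f sigma tau amin amax x0 x' alpha t d0 ->
  exists2 z : 'rV[R]_n,
    dot (z - x0) (z - x0)
      <= 2 * amax / (sigma * tau ^+ 2) * (f x0 - f x') &
    - dot (gradient f x0) d0 <= (f x0 - f x') / sigma +
      2 * amax / (1 - sigma) ^+ 2 *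
      dot (gradient f z - gradient f x0) (gradient f z - gradient f x0).
Proof.
move=> df /andP[s0 s1] tau0 amin0.
move=> [[/andP[a1 a2] /andP[t0 t1]] _ [q0 dq fdec] arm _].
set g := gradient f x0 in q0 dq fdec arm *.
set q := - dot g d0 in q0 dq fdec arm *.
set r := f x0 - f x'.
have tq : t * q <= r / sigma by rewrite ler_pdivlMr// /r; lra.
have tq0 : 0 < t * q by rewrite mulr_gt0.
have r0 : 0 <= r / sigma by apply: le_trans tq; exact: ltW.
have K0 : 0 <= 2 * amax / (1 - sigma) ^+ 2.
  by rewrite divr_ge0 ?sqr_ge0//; lra.
case: arm => [t_1|arm].
  exists x0; rewrite !subrr !dot0r ?mulr0 ?addr0.
    have -> : 2 * amax / (sigma * tau ^+ 2) * r =
        2 * amax / tau ^+ 2 * (r / sigma).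
      by field; rewrite !gt_eqF.
    by rewrite mulr_ge0// divr_ge0 ?sqr_ge0//; lra.
  by move: tq; rewrite t_1 mul1r.
have [th /andP[th0 th1] mvt] := MVT_gradient x0 ((t / tau) *: d0) df.
exists (x0 + th *: ((t / tau) *: d0)).
  rewrite addrAC subrr add0r.
  have -> : 2 * amax / (sigma * tau ^+ 2) * r =
      tau ^- 2 * (2 * amax * (r / sigma)).
    by field; rewrite !gt_eqF.
  have -> : dot (th *: ((t / tau) *: d0)) (th *: ((t / tau) *: d0)) =
      tau ^- 2 * (th * th * t * (t * dot d0 d0)).
    by rewrite !dotE; field; rewrite gt_eqF.
  rewrite ler_pM2l ?invr_gt0 ?exprn_gt0//.
  have td : 0 <= t * dot d0 d0 by rewrite mulr_ge0 ?dot_ge0// ltW.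
  have : t * dot d0 d0 <= t * (2 * amax * q) by rewrite ler_pM2l.
  have : th * th * t * (t * dot d0 d0) <= t * dot d0 d0.
    by rewrite ler_piMl// mulr_ile1// ?mulr_ge0// ?mulr_ile1// ltW.
  have : amax * (t * q) <= amax * (r / sigma) by rewrite ler_pM2l//; lra.
  lra.
set G := gradient f _ in mvt *.
have Dd : (1 - sigma) * q < dot (G - g) d0.
  have tt : 0 < t / tau by rewrite divr_gt0.
  move: mvt; rewrite dotZr => mvt.
  rewrite -(ltr_pM2l tt) dotDl dotNl; rewrite /q in arm *; lra.
have amax0 : 0 < amax by lra.
have s1' : 0 < 1 - sigma by lra.
have e0 : 0 < (1 - sigma) / (4 * amax) by rewrite divr_gt0//; lra.
(* this weight makes the [d0] term at most half of [(1 - sigma) q] *)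
have yg := dot_young (G - g) d0 e0.
have : (1 - sigma) / (4 * amax) * dot d0 d0 <= (1 - sigma) / 2 * q.
  have -> : (1 - sigma) / 2 * q = (1 - sigma) / (4 * amax) * (2 * amax * q).
    by field; rewrite gt_eqF.
  by rewrite ler_pM2l.
have -> : 2 * amax / (1 - sigma) ^+ 2 * dot (G - g) (G - g) =
  ((1 - sigma) / 2)^-1 *
  ((4 * ((1 - sigma) / (4 * amax)))^-1 * dot (G - g) (G - g)).
  by field; rewrite !gt_eqF.
move: ((4 * _)^-1 * _) yg => D yg h.
have hD : (1 - sigma) / 2 * q <= D by lra.
have : q <= ((1 - sigma) / 2)^-1 * D.
  by rewrite mulrC ler_pdivlMr ?divr_gt0// mulrC.
lra.
Qed.

(** The slopes tend to 0, hence so do the directions, and the variational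
    inequality of the projection, divided by [alpha k], passes to the limit. *)
Lemma descent_limit_stationary C f (sigma tau amin amax : R) x
    (alpha t : nat -> R) d (p y : 'rV[R]_n) :
  C1 f -> 0 < sigma < 1 -> 0 < tau -> 0 < amin ->
  (forall k, descent_step C f sigma tau amin amax (x k) (x k.+1)
               (alpha k) (t k) (d k)) ->
  x @ \oo --> p -> C y -> 0 <= dot (gradient f p) (y - p).
Proof.
move=> [df cg] s01 tau0 amin0 st xp Cy.
pose r k := f (x k) - f (x k.+1).
have fx : f (x k) @[k --> \oo] --> f p.
  exact: (cvg_comp _ _ xp (differentiable_continuous (df p))).
have r0 : r @ \oo --> 0.
  rewrite -(subrr (f p)); apply: cvgB => //.
  have := fx; rewrite -(cvg_shiftS (f \o x)); exact.
have gx : gradient f (x k) @[k --> \oo] --> gradient f p.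
  exact: (cvg_comp _ _ xp (cg p)).
have [z zP] := choice (fun k => let: ex_intro2 z h1 h2 :=
  descent_step_slope_le df s01 tau0 amin0 (st k) in ex_intro _ z (conj h1 h2)).
have zx : z k - x k @[k --> \oo] --> (0 : 'rV[R]_n).
  apply: cvg_dot_sub0; apply: cvg0_le => [k|].
    by rewrite subr0 dot_ge0; apply: (proj1 (zP k)).
  rewrite -[0](mulr0 (2 * amax / (sigma * tau ^+ 2))); exact: cvgMl_tmp.
have zp : z @ \oo --> p.
  have -> : z = (fun k => (z k - x k) + x k).
    by apply/funext => k; rewrite subrK.
  by rewrite -[p]add0r; apply: cvgD.
have gz : gradient f (z k) @[k --> \oo] --> gradient f p.
  exact: (cvg_comp _ _ zp (cg p)).
have gD : gradient f (z k) - gradient f (x k) @[k --> \oo] --> (0 : 'rV[R]_n).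
  by rewrite -(subrr (gradient f p)); apply: cvgB.
pose q k := - dot (gradient f (x k)) (d k).
have q0 : q @ \oo --> 0.
  apply: cvg0_le => [k|].
    have [_ _ [/ltW qk _ _] _ _] := st k; rewrite qk; apply: (proj2 (zP k)).
  have := cvgD (cvgMr_tmp (b := sigma^-1) r0)
    (cvgMl_tmp (a := 2 * amax / (1 - sigma) ^+ 2) (cvg_dot gD gD)).
  by rewrite dot0r mul0r mulr0 addr0; apply.
have d0 : d @ \oo --> (0 : 'rV[R]_n).
  apply: cvg_dot_sub0; apply: cvg0_le => [k|].
    by have [_ _ [_ dk _] _ _] := st k; rewrite subr0 dot_ge0; exact: dk.
  by rewrite -[0](mulr0 (2 * amax)); exact: cvgMl_tmp.
have yx : y - x k @[k --> \oo] --> y - p by apply: cvgB => //; exact: cvg_cst.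
(* [alpha k] need not converge: it is replaced by its lower bound [amin] *)
have lim : dot (gradient f (x k)) (y - x k) + q k
      + `|dot (d k) (y - x k)| / amin @[k --> \oo]
    --> dot (gradient f p) (y - p) + 0 + `|dot 0 (y - p)| / amin.
  apply: cvgD; first by apply: cvgD => //; exact: cvg_dot.
  by apply: cvgMr_tmp; apply: cvg_norm; exact: cvg_dot.
rewrite [dot 0 _]dotC dot0r normr0 mul0r !addr0 in lim.
apply: (cvgr_to_ge lim); apply: nearW => k.
have [[/andP[a1 _] _] _ _ _ /(_ _ Cy)[+ _]] := st k; rewrite -/(q k).
have ak : 0 < alpha k by lra.
rewrite -mulrDr; move: (dot (gradient f (x k)) _ + q k) => b hb.
have : dot (d k) (y - x k) / alpha k <= `|dot (d k) (y - x k)| / amin.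
  apply: (@le_trans _ _ (`|dot (d k) (y - x k)| / alpha k)).
    by rewrite ler_pM2r ?invr_gt0// ler_norm.
  by rewrite ler_wpM2l// lef_pV2.
have : 0 <= b + dot (d k) (y - x k) / alpha k.
  by rewrite -(pmulr_rge0 _ ak) mulrDr mulrCA mulfV ?mulr1// gt_eqF.
lra.
Qed.

End Limits.

(** * Convergence of the method *)

Theorem theorem23 (R : realType) (n : nat)
  (C : set 'rV[R]_n) (f : 'rV[R]_n -> R)
  (phi : R -> 'rV[R]_n -> 'rV[R]_n -> R)
  (sigma tau amin amax gbar : R)
  (x0 : 'rV[R]_n) (x : nat -> 'rV[R]_n)
  (C_nonempty : C !=set0) (C_closed : closed C) (C_convex : convex_set C)
  (f_C1 : C1 f) (phi_tol : error_tolerance phi)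
  (sigma01 : 0 < sigma < 1) (tau01 : 0 < tau < 1)
  (amin_gt0 : 0 < amin) (amin_le_amax : amin <= amax)
  (gbar_lt : gbar < 1 / 2) (x0C : C x0)
  (x_gen : GInexPM_generated f C phi sigma tau amin amax gbar x0 x)
  (f_pseudoconvex : pseudoconvex_on f C) :
  [/\ minimizers f C !=set0 <-> cluster (x @ \oo) !=set0,
      minimizers f C !=set0 ->
        exists2 xstar, minimizers f C xstar & x @ \oo --> xstar &
      minimizers f C = set0 ->
        enorm (x k) @[k --> \oo] --> +oo /\
        (f (x k))%:E @[k --> \oo] --> ereal_inf [set (f y)%:E | y in C]].
Proof.
case: x_gen => x_0 x_step.
have [sigma_gt0 _] := andP sigma01; have [tau_gt0 _] := andP tau01.
have inC k : C (x k).
  elim: k => [|k IH]; first by rewrite x_0.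
  have [a [t [d [_ [_ ?] _ _ _]]]] := GInexPM_descent_step C_convex phi_tol
    sigma01 tau01 amin_gt0 gbar_lt IH (x_step k).
  by [].
have /choice[s sP] k : exists s : R * R * 'rV[R]_n,
    descent_step C f sigma tau amin amax (x k) (x k.+1) s.1.1 s.1.2 s.2.
  have [a [t [d ?]]] := GInexPM_descent_step C_convex phi_tol
    sigma01 tau01 amin_gt0 gbar_lt (inC k) (x_step k).
  by exists (a, t, d).
have f_lt k : f (x k.+1) < f (x k).
  have [[_ /andP[t0 _]] _ [q0 _ fdec] _ _] := sP k.
  by apply: le_lt_trans fdec _; rewrite ltrBlDr ltrDl !mulr_gt0.
have f_mono : nonincreasing_seq (f \o x).
  by apply/nonincreasing_seqP => k; exact: ltW (f_lt k).
(* the points that no iterate undercuts; [h y] is the Lyapunov function *)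
pose T := [set y | C y /\ forall k, f y <= f (x k)].
pose h y u := dot (u - y) (u - y) + 2 * amax / sigma * f u.
have h_mono y : T y -> nonincreasing_seq (h y \o x).
  move=> [Cy fy]; apply/nonincreasing_seqP => k /=.
  apply: descent_step_lyapunov (sP k) => //.
  exact: le_lt_trans (fy _) (f_lt k).
have f_cont p : {for p, continuous f}.
  by apply: differentiable_continuous; case: f_C1.
have cluster_T p : cluster (x @ \oo) p -> T p.
  move=> clp; split; first exact: cluster_closed clp.
  have fx := cluster_nonincreasing_cvg (@f_cont p) f_mono clp.
  move=> k; apply: (cvgr_to_le fx).
  by exists k => // m /= /f_mono.
have cluster_cvg p : cluster (x @ \oo) p -> x @ \oo --> p.
  move=> clp; apply: cvg_dot_sub0.
  have fx := cluster_nonincreasing_cvg (@f_cont p) f_mono clp.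
  have h_cont : {for p, continuous (h p)}.
    exact: (cvgD (@continuous_dist_sqr R n p p)
                 (cvgMl_tmp (a := 2 * amax / sigma) (@f_cont p))).
  have hx := cluster_nonincreasing_cvg h_cont (h_mono _ (cluster_T _ clp)) clp.
  have -> : (fun k => dot (x k - p) (x k - p)) =
      (fun k => h p (x k) - 2 * amax / sigma * f (x k)).
    by apply/funext => k; rewrite /h addrK.
  have <- : h p p - 2 * amax / sigma * f p = 0.
    by rewrite /h subrr dot0r add0r subrr.
  exact: (cvgB hx (cvgMl_tmp (a := 2 * amax / sigma) fx)).
have cluster_min p : cluster (x @ \oo) p -> minimizers f C p.
  move=> clp; have [Cp _] := cluster_T _ clp; split=> // y Cy.
  apply: f_pseudoconvex => //.
  exact: descent_limit_stationary f_C1 sigma01 tau_gt0 amin_gt0 sP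
           (cluster_cvg _ clp) Cy.
have T_cluster y : T y -> cluster (x @ \oo) !=set0.
  move=> Ty; apply: contrapT => /nonemptyPn cl0.
  pose K := @compact_euclidean_ball R n y
              (h y (x 0%N) - 2 * amax / sigma * f y).
  have [k] := filter_ex (cluster0_compact_near_notin K cl0).
  apply => /=; rewrite lerBrDr; apply: le_trans (h_mono _ Ty _ _ (leq0n k)).
  rewrite /= /h lerD2l ler_wpM2l ?(proj2 Ty)// divr_ge0 ?(ltW sigma_gt0)//.
  by rewrite mulr_ge0// (le_trans (ltW amin_gt0)).
have min_T y : minimizers f C y -> T y.
  by move=> [Cy ymin]; split=> // k; exact/ymin/inC.
split.
- split=> [[y /min_T/T_cluster]|[p /cluster_min]] //.
  by exists p.
- move=> [y /min_T/T_cluster[p clp]]; exists p; first exact: cluster_min.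
  exact: cluster_cvg.
- move=> min0.
  have cl0 : cluster (x @ \oo) = set0.
    by rewrite -subset0 -min0 => p; exact: cluster_min.
  split; first exact: cluster0_enorm_cvgy.
  have -> : ereal_inf [set (f y)%:E | y in C] =
      ereal_inf (range (EFin \o f \o x)).
    apply/eqP; rewrite eq_le; apply/andP; split.
      by apply: ereal_inf_le_tmp => _ [k _ <-]; exists (x k).
    apply: le_ereal_inf_tmp => _ [y Cy <-].
    (* otherwise [y] would be in [T], and the sequence would cluster *)
    have [k fk] : exists k, f (x k) <= f y.
      apply: contrapT => /forallNP nk.
      have : T y by split=> // k; have /negP := nk k; rewrite -ltNge => /ltW.
      by move=> /T_cluster; rewrite cl0 => -[].
    by apply: ge_ereal_inf; exists (f (x k))%:E; [exists k|rewrite lee_fin].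
  apply: ereal_nonincreasing_cvgn => i j ij; rewrite lee_fin; exact: f_mono.
Qed.
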